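(* Let $\mathcal{A}=(\mathbb{G}_a^m,\Phi)$ be an abelian uniformizable $T$-module of dimension $m$. Then there exists a positive integer $j(\mathcal{A})$, depending only on $\mathcal{A}$, such that for every subring $B$ of $A$ with $B\not\subseteq\mathbb{F}_q$, every sub-$B$-module of $\mathcal{A}$ is a sub-$T^{j(\mathcal{A})}$-module of $\mathcal{A}$.
   Context: Let $A=\mathbb{F}_q[T]$, $k=\mathbb{F}_q(T)$, $\mathcal{C}$ the completion of an algebraic closure of $k_\infty$, $\tau$ the Frobenius $z\mapsto z^q$. A $T$-module of dimension $m$ defined over $\mathcal{F}\subset\overline{k}$ is $\mathcal{A}=(\mathbb{G}_a^m,\Phi)$ with $\Phi:A\to\mathcal{F}^{m,m}\{\tau\}$ an $\mathbb{F}_q$-algebra homomorphism, $\Phi(T)=\sum_{i=0}^{\tilde d}a_i\tau^i$, $a_{\tilde d}\ne0$, $a_0=TI_m+N$ with $N$ nilpotent. $\mathcal{A}$ is abelian if $\mathrm{Hom}_{\mathcal{F}}(\mathcal{A},\mathbb{G}_a)\cong\mathcal{F}\{\tau\}^m$, an $\mathcal{F}[T]$-module via $T\cdot f=f\circ\Phi(T)$, has finite rank; it is uniformizable if its exponential map $e:\mathcal{C}^m\to\mathcal{A}(\mathcal{C})$ (the unique $\mathbb{F}_q$-linear entire map with differential the identity at $0$ satisfying $e(d\Phi(T)z)=\Phi(T)(e(z))$) is surjective. For a subring $B\subseteq A$, a sub-$B$-module of $\mathcal{A}$ is a reduced connected algebraic subgroup $\mathcal{B}\subseteq\mathbb{G}_a^m$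 with $\Phi(a)(\mathcal{B})\subseteq\mathcal{B}$ for all $a\in B$. For $a\in A\setminus\mathbb{F}_q$, a sub-$a$-module is a reduced connected algebraic subgroup $\mathcal{B}$ with $\Phi(a)(\mathcal{B})\subseteq\mathcal{B}$; a sub-$T^j$-module is the case $a=T^j$. *)

(* Defs.v *)
From HB Require Import structures.
From mathcomp Require Import all_boot all_order all_algebra all_field.
From mathcomp Require Import reals.
From mathcomp Require mpoly.
Set Implicit Arguments. Unset Strict Implicit. Unset Printing Implicit Defensive.
Import Order.TTheory GRing.Theory Num.Theory.
Local Open Scope ring_scope.

Section Ambient.
Variables (F : finFieldType) (C : closedFieldType) (iota : {rmorphism F -> C})
  (t : C) (R : realType) (av : C -> R).

Definition evalA (a : {poly F}) : C := (map_poly iota a).[t].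

Definition algebraic_k (y : C) : Prop :=
  exists P : {poly {poly F}}, P != 0 /\ (map_poly evalA P).[y] = 0.

Definition av_cauchy (u : nat -> C) : Prop :=
  forall eps : R, 0 < eps -> exists N, forall n k, (N <= n)%N -> (N <= k)%N ->
    av (u n - u k) < eps.

Definition av_lim (u : nat -> C) (l : C) : Prop :=
  forall eps : R, 0 < eps -> exists N, forall n, (N <= n)%N -> av (u n - l) < eps.

(* (C, iota, t, av) is a model of C_infty: a complete, algebraically closed
   non-archimedean valued field containing k = F_q(T) with the absolute value
   |.|_infty (|T| = q), in which \bar k is dense; such a field is the
   completion of an algebraic closure of k_infty. *)
Record Cinfty_model : Prop := {
  av_ge0 : forall x, 0 <= av x;
  av_eq0 : forall x, av x = 0 <-> x = 0;
  avM : forall x y, av (x * y) = av x * av y;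
  av_ultra : forall x y, av (x + y) <= Num.max (av x) (av y);
  av_iota : forall c : F, c != 0 -> av (iota c) = 1;
  av_t : av t = (#|F|)%:R;
  t_transc : forall a : {poly F}, evalA a = 0 -> a = 0;
  av_complete : forall u, av_cauchy u -> exists l, av_lim u l;
  kbar_dense : forall x (eps : R), 0 < eps ->
     exists y, algebraic_k y /\ av (x - y) < eps
}.

Variable m : nat.

Definition frobn (n : nat) {r c : nat} (M : 'M[C]_(r, c)) : 'M[C]_(r, c) :=
  map_mx (fun z => z ^+ (#|F| ^ n)) M.

(* evaluation of a twisted polynomial  sum_i s_i tau^i  in C^{m,m}{tau}
   at a point x of C^m (column vectors) *)
Definition apply_tw (s : seq 'M[C]_m) (x : 'cV[C]_m) : 'cV[C]_m :=
  \sum_(i < size s) s`_i *m frobn i x.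

(* Phi is determined by phiT := Phi(T) = sum_i a_i tau^i ;
   Phi(a) for a = sum_k c_k T^k in A acts by  sum_k c_k Phi(T)^k. *)
Definition Phi (phiT : seq 'M[C]_m) (a : {poly F}) (x : 'cV[C]_m) : 'cV[C]_m :=
  \sum_(k < size a) iota a`_k *: iter k (apply_tw phiT) x.

Definition is_subfield (K : C -> Prop) : Prop :=
  [/\ K 0, K 1, (forall x y, K x -> K y -> K (x - y)),
      (forall x y, K x -> K y -> K (x * y)) & (forall x, K x -> K x^-1)].

Definition is_Tmodule (K : C -> Prop) (phiT : seq 'M[C]_m) : Prop :=
  [/\ (forall i (j k : 'I_m), K (phiT`_i j k)),
      last 0 phiT != 0 &
      exists n, (phiT`_0 - t%:M) ^+ n = 0].

(* Hom_K(A, G_a) = K{tau}^m : f = sum_j b_j tau^j, b_j in K^m (row vectors) *)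
Definition hom_fun (b : seq 'rV[C]_m) (x : 'cV[C]_m) : C :=
  \sum_(j < size b) (b`_j *m frobn j x) 0 0.

Definition row_in (K : C -> Prop) (b : 'rV[C]_m) := forall j, K (b 0 j).
Definition poly_in (K : C -> Prop) (P : {poly C}) := forall k, K P`_k.

Definition hom_act (phiT : seq 'M[C]_m) (P : {poly C}) (f : 'cV[C]_m -> C)
  (x : 'cV[C]_m) : C :=
  \sum_(k < size P) P`_k * f (iter k (apply_tw phiT) x).

Definition hom_lin_indep (K : C -> Prop) (phiT : seq 'M[C]_m)
  (fs : seq (seq 'rV[C]_m)) : Prop :=
  forall Ps : seq {poly C}, size Ps = size fs ->
    (forall i, poly_in K (nth 0 Ps i)) ->
    (forall x, \sum_(i < size fs) hom_act phiT (nth 0 Ps i) (hom_fun (nth [::] fs i)) x = 0) ->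
    forall i, nth 0 Ps i = 0.

(* abelian: Hom_K(A, G_a) has finite rank over K[T] *)
Definition is_abelian (K : C -> Prop) (phiT : seq 'M[C]_m) : Prop :=
  exists r : nat, forall fs : seq (seq 'rV[C]_m),
    (forall i, forall b, b \in nth [::] fs i -> row_in K b) ->
    hom_lin_indep K phiT fs -> (size fs <= r)%N.

Definition vnorm (x : 'cV[C]_m) : R := \big[Num.max/0]_(i < m) av (x i 0).

Definition exp_conv (E : nat -> 'M[C]_m) (z w : 'cV[C]_m) : Prop :=
  forall eps : R, 0 < eps -> exists N, forall n, (N <= n)%N ->
    vnorm ((\sum_(i < n) E i *m frobn i z) - w) < eps.

(* uniformizable: the exponential e(z) = sum_i E_i z^(q^i) (an entire
   F_q-linear map with E_0 = identity) satisfying e(a_0 z) = Phi(T)(e(z))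
   is surjective *)
Definition is_uniformizable (phiT : seq 'M[C]_m) : Prop :=
  exists E : nat -> 'M[C]_m,
    [/\ E 0%N = 1%:M,
        (forall z, exists w, exp_conv E z w),
        (forall z w, exp_conv E z w -> exp_conv E (phiT`_0 *m z) (apply_tw phiT w)) &
        (forall w, exists z, exp_conv E z w)].

Definition zariski_closed (S : 'cV[C]_m -> Prop) : Prop :=
  exists P : mpoly.mpoly m C -> Prop,
    forall x, S x <-> (forall p, P p -> mpoly.meval (fun i => x i 0) p = 0).

Definition zariski_connected (S : 'cV[C]_m -> Prop) : Prop :=
  forall U V : 'cV[C]_m -> Prop, zariski_closed U -> zariski_closed V ->
    (forall x, S x -> U x \/ V x) -> (forall x, S x -> U x -> V x -> False) ->
    (forall x, S x -> U x) \/ (forall x, S x -> V x).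

Definition conn_alg_subgroup (S : 'cV[C]_m -> Prop) : Prop :=
  [/\ S 0, (forall x y, S x -> S y -> S (x - y)),
      zariski_closed S & zariski_connected S].

Definition is_subring (B : {poly F} -> Prop) : Prop :=
  [/\ B 1, (forall a b, B a -> B b -> B (a - b)) &
      (forall a b, B a -> B b -> B (a * b))].

Definition sub_B_module (phiT : seq 'M[C]_m) (B : {poly F} -> Prop)
  (S : 'cV[C]_m -> Prop) : Prop :=
  conn_alg_subgroup S /\ forall b, B b -> forall x, S x -> S (Phi phiT b x).

Definition sub_a_module (phiT : seq 'M[C]_m) (a : {poly F})
  (S : 'cV[C]_m -> Prop) : Prop :=
  conn_alg_subgroup S /\ forall x, S x -> S (Phi phiT a x).

End Ambient.

(* Main.v *)
Require Import Defs.
From HB Require Import structures.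
From mathcomp Require Import all_boot all_order all_algebra all_field.
From mathcomp Require Import reals.
From mathcomp Require mpoly.
From mathcomp Require Import boolp mpoly ring.
Import Order.TTheory GRing.Theory Num.Theory.
Local Open Scope ring_scope.

Set Implicit Arguments. Unset Strict Implicit. Unset Printing Implicit Defensive.

(* Put j = p^n, where p is the characteristic and N^n = 0 for the nilpotent part
   N of dPhi(T): then Phi(T)^j and Phi(a)^j, for any a, have scalar differentials
   t^j and b = a(t)^j. Let S be stable under Phi(a). It is the zero set of the
   additive polynomials vanishing on it, so let f be one of them. The additive
   polynomial f o Phi(T)^j has no linear part modulo those vanishing on S, hence
   is a p-th power x^p on S; comparing the actions of Phi(a)^j on both sides of
   such an identity f o Phi(T)^j = x^(p^i), where the multipliers b and
   b^(1/p^i) differ because t is transcendental, shows that x is a p-th power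
   again. So f o Phi(T)^j is a p^i-th power on S for every i; as C{tau}^m is
   noetherian and S connected, it vanishes on S. *)

(** * Additive polynomials *)

Section PerfectField.
Variables (C : closedFieldType) (p : nat).
Hypothesis charC : p \in [pchar C].

Lemma pchar_gt0 : (0 < p)%N.
Proof. exact/prime_gt0/(pcharf_prime charC). Qed.

Lemma exprp_add (x y : C) : (x + y) ^+ p = x ^+ p + y ^+ p.
Proof. by rewrite -!(pFrobenius_autE charC) rmorphD. Qed.

Lemma exprp_sub (x y : C) : (x - y) ^+ p = x ^+ p - y ^+ p.
Proof. by rewrite -!(pFrobenius_autE charC) rmorphB. Qed.

Lemma exprp_inj : injective (fun x : C => x ^+ p).
Proof.
move=> x y /= /eqP; rewrite -subr_eq0 -exprp_sub expf_eq0 pchar_gt0 /=.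
by rewrite subr_eq0 => /eqP.
Qed.

Lemma exprp_surj (x : C) : exists y, y ^+ p = x.
Proof.
have /closed_rootP[y] : size ('X^p - x%:P) != 1.
  by rewrite size_XnsubC ?pchar_gt0 // eqSS -lt0n pchar_gt0.
by rewrite rootE !hornerE subr_eq0 => /eqP; exists y.
Qed.

Lemma poly_fun_eq0 (u : {poly C}) : (forall x, u.[x] = 0) -> u = 0.
Proof.
move=> u0; apply/eqP/negPn/negP => /closed_nonrootP[x].
by rewrite rootE u0 eqxx.
Qed.

(** A zero derivative leaves only exponents divisible by [p], and the remaining coefficients have
    [p]-th roots in [C]. The size bound drives the induction in [addpoly_horner]. *)
Lemma poly_deriv0_exprp (u : {poly C}) :
  u^`() = 0 -> exists2 w : {poly C}, (size w <= (size u).-1 %/ p + 1)%N &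
    forall x, u.[x] = w.[x] ^+ p.
Proof.
move=> du0; have [rt rtE] := choice exprp_surj.
pose w := \poly_(i < (size u).-1 %/ p + 1) rt u`_(i * p).
exists w; first exact: size_poly.
suff -> : u = map_poly (pFrobenius_aut charC) w \Po 'X^p.
  move=> x; rewrite horner_comp hornerXn -!(pFrobenius_autE charC).
  by rewrite horner_map.
apply/polyP => i; rewrite coef_comp_poly_Xn ?pchar_gt0 // coef_map /=.
case: ifPn => [/dvdnP[k ->]|ndvd].
  rewrite mulnK ?pchar_gt0 // coef_poly; case: ltnP => [_|].
    by rewrite pFrobenius_autE rtE.
  rewrite addn1 => lek; rewrite rmorph0 nth_default //.
  rewrite -ltnS in lek; move: lek; rewrite ltnS ltn_divLR ?pchar_gt0 //.
  by case: (size u).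
have i0 : (0 < i)%N by case: i ndvd; rewrite ?dvdn0.
have /eqP := congr1 (fun q : {poly C} => q`_i.-1) du0.
rewrite coef_deriv coef0 prednK // -mulr_natr mulf_eq0 => /orP[/eqP //|].
by rewrite -(dvdn_pcharf charC) (negbTE ndvd).
Qed.

End PerfectField.

(** These are the functions given by [C{tau_p}^m], where [tau_p] is the [p]-power map rather than
    the [q]-power map. *)
Inductive addpoly {C : closedFieldType} (p : nat) {m : nat} :
  ('cV[C]_m -> C) -> Prop :=
| addpoly0 : addpoly p (fun=> 0)
| addpoly_coord j : addpoly p (fun x => x j 0)
| addpolyD f g : addpoly p f -> addpoly p g -> addpoly p (fun x => f x + g x)
| addpolyZ c f : addpoly p f -> addpoly p (fun x => c * f x)
| addpolyX f : addpoly p f -> addpoly p (fun x => f x ^+ p).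

Section AdditivePolynomials.
Variables (C : closedFieldType) (p : nat) (m : nat).
Hypothesis charC : p \in [pchar C].
Implicit Types (f g : 'cV[C]_m -> C) (x y s : 'cV[C]_m).
Local Notation addpoly := (addpoly p).

Lemma addpoly_ext f g : f =1 g -> addpoly f -> addpoly g.
Proof. by move=> /funext ->. Qed.

Lemma addpolyB f g : addpoly f -> addpoly g -> addpoly (fun x => f x - g x).
Proof.
move=> Of Og; have := addpolyD Of (addpolyZ (-1) Og).
by apply: addpoly_ext => x; rewrite mulN1r.
Qed.

Lemma addpoly_sum (I : Type) (r : seq I) (F : I -> 'cV[C]_m -> C) :
  (forall i, addpoly (F i)) -> addpoly (fun x => \sum_(i <- r) F i x).
Proof.
move=> OF; elim: r => [|i r IH].
  by apply: addpoly_ext (addpoly0 p) => x; rewrite big_nil.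
by apply: addpoly_ext (addpolyD (OF i) IH) => x; rewrite big_cons.
Qed.

Lemma addpolyXn n f : addpoly f -> addpoly (fun x => f x ^+ (p ^ n)).
Proof.
move=> Of; elim: n => [|n IH]; first by apply: addpoly_ext Of => x; rewrite expr1.
by apply: addpoly_ext (addpolyX IH) => x; rewrite -exprM expnSr.
Qed.

(** An additive [u] has constant derivative [c], so [u - c X] is the [p]-th power of an additive
    polynomial of smaller size, to which induction applies. *)
Lemma addpoly_horner (u : {poly C}) f : addpoly f ->
  (forall a b, u.[a + b] = u.[a] + u.[b]) -> addpoly (fun x => u.[f x]).
Proof.
move=> Of; move: {2}(size u) (leqnn (size u)) => n.
elim: n u => [|n IH] u leu addu.
  move: leu; rewrite leqn0 size_poly_eq0 => /eqP ->.
  by apply: addpoly_ext (addpoly0 p) => x; rewrite horner0.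
have [u1|u1] := leqP (size u) 1.
  have u0 : u.[0] = 0.
    by apply/eqP; rewrite -(inj_eq (addrI u.[0])) -addu !addr0.
  apply: addpoly_ext (addpoly0 p) => x.
  by rewrite -u0 (size1_polyC u1) !hornerC.
have du_const (y : C) : u^`().[y] = u^`().[0].
  have : u \Po ('X + y%:P) = u + u.[y]%:P.
    apply/eqP; rewrite -subr_eq0; apply/eqP/poly_fun_eq0 => x.
    by rewrite !hornerE horner_comp !hornerE addu subrr.
  move/(congr1 (fun q : {poly C} => q^`().[0])).
  rewrite deriv_comp !derivD derivX !derivC !addr0 mulr1 horner_comp !hornerE.
  by [].
pose c := u^`().[0]; pose v := u - c *: 'X.
have dv : v^`() = 0.
  rewrite derivB derivZ derivX; apply: poly_fun_eq0 => x.
  by rewrite !hornerE du_const subrr.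
have addv a b : v.[a + b] = v.[a] + v.[b].
  rewrite /v !(hornerD, hornerN, hornerZ, hornerX) addu; ring.
have [w lew wE] := poly_deriv0_exprp charC dv.
have addw a b : w.[a + b] = w.[a] + w.[b].
  by apply: (exprp_inj charC); rewrite /= (exprp_add charC) -!wE addv.
suff Ow : addpoly (fun x => w.[f x]).
  apply: addpoly_ext (addpolyD (addpolyX Ow) (addpolyZ c Of)) => x.
  by rewrite -wE /v !(hornerD, hornerN, hornerZ, hornerX) subrK.
apply: IH => //; rewrite (leq_trans lew) // addn1.
have lev : (size v <= n.+1)%N.
  apply: leq_trans (size_polyD _ _) _; rewrite geq_max leu size_polyN.
  apply: leq_trans (size_scale_leq _ _) _; rewrite size_polyX.
  exact: leq_trans u1 leu.
have [v1|v1] := posnP (size v).-1.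
  by rewrite v1 div0n -ltnS (leq_trans u1).
apply: leq_trans (_ : (size v).-1 <= n)%N; last by case: (size v) lev.
by apply: ltn_Pdiv => //; exact/prime_gt1/(pcharf_prime charC).
Qed.
End AdditivePolynomials.

(** * Closed subgroups are cut out by additive polynomials *)

Section ClosedSubgroups.
Variables (C : closedFieldType) (m : nat).
Implicit Types (r q : {mpoly C[m]}) (a b : 'X_{1..m}) (x y s : 'cV[C]_m).
Implicit Types (S : 'cV[C]_m -> Prop) (P Q : 'X_{1..m} -> Prop).

Definition evalmp r x : C := r.@[fun i => x i 0].

Definition supp_in P r := forall b, b \in msupp r -> P b.

Lemma supp_inD P r q : supp_in P r -> supp_in P q -> supp_in P (r + q).
Proof.
by move=> rP qP b /msuppD_le; rewrite mem_cat => /orP[/rP|/qP].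
Qed.

Lemma supp_inZ P c r : supp_in P r -> supp_in P (c *: r).
Proof. by move=> rP b /msuppZ_le /rP. Qed.

Lemma supp_inB P r q : supp_in P r -> supp_in P q -> supp_in P (r - q).
Proof.
by move=> rP qP b /msuppB_le; rewrite mem_cat => /orP[/rP|/qP].
Qed.

(** Linear extension from monomials: [E] is compatible with linear combinations, as is agreement on
    a set, so each monomial can be replaced separately. *)
Lemma supp_in_lin P Q r (E : {mpoly C[m]} -> {mpoly C[m]} -> Prop) :
  E 0 0 ->
  (forall c r1 r2 q1 q2, E r1 q1 -> E r2 q2 -> E (c *: r1 + r2) (c *: q1 + q2)) ->
  (forall b, P b -> exists2 q, supp_in Q q & E 'X_[b] q) ->
  supp_in P r -> exists2 q, supp_in Q q & E r q.
Proof.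
move=> E0 Elin EX; rewrite {2}(mpolyE r) /supp_in.
elim: (msupp r) => [|b s IH] rP.
  by exists 0; rewrite ?big_nil // => b; rewrite msupp0.
have [|q qQ Eq] := IH; first by move=> d ds; apply: rP; rewrite inE ds orbT.
have [|q' q'Q Eq'] := EX b; first by apply: rP; rewrite inE eqxx.
exists (r@_b *: q' + q); last by rewrite big_cons; apply: Elin.
by apply: supp_inD => //; apply: supp_inZ.
Qed.

Definition shiftmp y r :=
  r \mPo [tuple 'X_i + (y i 0)%:MP_[m] | i < m].

Lemma eval_shiftmp y r x : evalmp (shiftmp y r) x = evalmp r (x + y).
Proof.
rewrite /evalmp comp_mpoly_meval; apply: meval_eq => i.
by rewrite tnth_mktuple mevalD mevalXU mevalC mxE.
Qed.

(** Strict divisibility of monomials, which the total monomial order [<] refines. *)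
Definition slt b a := (b <= a)%MM /\ b <> a.

Lemma slt_lt b a : slt b a -> (b < a)%O.
Proof. by case=> ba nba; rewrite lt_neqAle lem_leo // andbT; apply/eqP. Qed.

Lemma slt_addl b a d : slt b a -> slt (d + b)%MM (d + a)%MM.
Proof.
case=> /mnm_lepP ba nba; split; last by move/addmI.
by apply/mnm_lepP => i; rewrite !mnmDE leq_add2l.
Qed.

Lemma slt_add b a b' a' : slt b a -> slt b' a' -> slt (b + b')%MM (a + a')%MM.
Proof.
move=> sba sba'; have := slt_lt sba; case: sba => /mnm_lepP ba _ lba.
have lba' := slt_lt sba'; case: sba' => /mnm_lepP ba' _.
split; first by apply/mnm_lepP => i; rewrite !mnmDE leq_add.
by move=> e; have := ltm_add lba lba'; rewrite e ltxx.
Qed.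

Lemma shiftmpX y a : exists2 r, supp_in (slt^~ a) r & shiftmp y 'X_[a] = 'X_[a] + r.
Proof.
(* [G] holds for each factor [X_i + y_i] and is stable under products, since the cross terms involve
   proper divisors of the product monomial only. *)
pose G (q : {mpoly C[m]}) b := exists2 r, supp_in (slt^~ b) r & q = 'X_[b] + r.
have G1 : G 1 0%MM.
  by exists 0; rewrite ?addr0 ?mpolyX0 // => b; rewrite msupp0.
have GM q q' b b' : G q b -> G q' b' -> G (q * q') (b + b')%MM.
  move=> [r rb ->] [r' rb' ->]; exists ('X_[b] * r' + r * 'X_[b'] + r * r').
    have sM P1 P2 P3 u v : supp_in P1 u -> supp_in P2 v ->
        (forall c d, P1 c -> P2 d -> P3 (c + d)%MM) -> supp_in P3 (u * v).
      move=> u1 v2 P12 d /msuppM_le /allpairsP[[c1 c2] /= [/u1 c1P /v2 c2P ->]].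
      exact: P12.
    have sX c : supp_in (eq c) 'X_[c] by move=> d; rewrite msuppX inE => /eqP.
    apply: supp_inD; last by apply: sM rb rb' _ => c d; apply: slt_add.
    apply: supp_inD.
      by apply: sM (sX b) rb' _ => c d <-; apply: slt_addl.
    apply: sM rb (sX b') _ => c d sc <-; rewrite ![(_ + b')%MM]addmC.
    exact: slt_addl.
  by rewrite mpolyXD; ring.
have GX (H : {mpoly C[m]} -> 'X_{1..m} -> Prop) : H 1 0%MM ->
    (forall q q' b b', H q b -> H q' b' -> H (q * q') (b + b')%MM) ->
    (forall i, H ('X_i + (y i 0)%:MP) U_(i)%MM) -> H (shiftmp y 'X_[a]) a.
  move=> H1 HM HX; rewrite /shiftmp comp_mpolyX {2}[a]multinomUE_id.
  apply: (big_ind2 H) => // [q b q' b'|i _]; first exact: HM.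
  rewrite tnth_mktuple; elim: (a i) => [|k IH]; first by rewrite expr0 mulm0n.
  by rewrite exprS mulmS; apply: HM.
apply: (GX G) => // i; exists (y i 0)%:MP => // b; rewrite msuppC.
case: eqP => // _; rewrite inE => /eqP ->.
split; first by apply/mnm_lepP => j; rewrite mnm0E.
by move/(congr1 mdeg); rewrite mdeg0 mdeg1.
Qed.

Lemma shiftmpD y r q : shiftmp y (r + q) = shiftmp y r + shiftmp y q.
Proof. exact: comp_mpolyD. Qed.

Lemma shiftmpB y r q : shiftmp y (r - q) = shiftmp y r - shiftmp y q.
Proof. exact: comp_mpolyB. Qed.

Lemma shiftmpZ y c r : shiftmp y (c *: r) = c *: shiftmp y r.
Proof. exact: comp_mpolyZ. Qed.

Lemma supp_in_shiftmp P y r :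
  (forall b a, P a -> (b <= a)%MM -> P b) -> supp_in P r -> supp_in P (shiftmp y r).
Proof.
move=> Pdown rP.
have [||b Pb|//|q qP ->] := @supp_in_lin P P r (fun r q => shiftmp y r = q).
- by rewrite /shiftmp comp_mpoly0.
- by move=> c r1 r2 q1 q2 <- <-; rewrite shiftmpD shiftmpZ.
- have [q qb ->] := shiftmpX y b; exists ('X_[b] + q) => //.
  apply: supp_inD => [d|d /qb[db _]]; last exact: Pdown db.
  by rewrite msuppX inE => /eqP ->.
- by [].
Qed.

(** An additive function is the sum of its restrictions to the coordinate axes, each an additive
    polynomial in one variable. *)
Lemma addpoly_evalmp p r : p \in [pchar C] ->
  (forall x y, evalmp r (x + y) = evalmp r x + evalmp r y) ->
  addpoly p (evalmp r).
Proof.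
move=> charC addr.
have /choice[u uE] (j : 'I_m) : exists u : {poly C},
    forall c, evalmp r (c *: delta_mx j 0) = u.[c].
  (* This is [r] with [X] substituted for the [j]-th variable and 0 for the others. *)
  exists (\sum_(b <- msupp r) r@_b *: \prod_(i < m) ((i == j)%:R *: 'X) ^+ b i) => c.
  rewrite /evalmp mevalE horner_sum; apply: eq_bigr => b _.
  rewrite hornerZ horner_prod; congr (_ * _); apply: eq_bigr => i _.
  by rewrite horner_exp hornerZ hornerX !mxE eqxx andbT mulrC.
have e0 : evalmp r 0 = 0.
  by apply/eqP; rewrite -(inj_eq (addrI (evalmp r 0))) -addr !addr0.
have rE x : evalmp r x = \sum_j (u j).[x j 0].
  have {1}-> : x = \sum_j x j 0 *: delta_mx j 0.
    apply/matrixP => i k; rewrite summxE (bigD1 i) //= big1 ?addr0 => [|j ji].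
      by rewrite !mxE !ord1 !eqxx mulr1.
    by rewrite !mxE eq_sym (negbTE ji) mulr0.
  rewrite (big_morph (evalmp r) addr e0).
  by apply: eq_bigr => j _; rewrite uE.
apply: addpoly_ext (fun x => esym (rE x)) _; apply: addpoly_sum => j.
apply: addpoly_horner => //; first exact: addpoly_coord.
by move=> c d; rewrite -!uE scalerDl addr.
Qed.

(* Complement of the leading monomials of the ideal of S, as in Groebner bases. *)
Definition standard S a := ~ exists2 r, supp_in (fun b => b < a)%O r &
  forall x, S x -> evalmp 'X_[a] x = evalmp r x.

Lemma evalmpD r q x : evalmp (r + q) x = evalmp r x + evalmp q x.
Proof. exact: mevalD. Qed.
Lemma evalmpB r q x : evalmp (r - q) x = evalmp r x - evalmp q x.
Proof. exact: mevalB. Qed.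
Lemma evalmpM r q x : evalmp (r * q) x = evalmp r x * evalmp q x.
Proof. exact: mevalM. Qed.
Lemma evalmpZ c r x : evalmp (c *: r) x = c * evalmp r x.
Proof. exact: mevalZ. Qed.

Lemma supp_in_mulX b a r : (b <= a)%MM -> supp_in (fun d => d < b)%O r ->
  supp_in (fun d => d < a)%O ('X_[a - b] * r).
Proof.
move=> ba rb d /msuppM_le /allpairsP[[c1 c2] /= []].
rewrite msuppX inE => /eqP -> /rb c2b ->.
by rewrite -[a in X in (_ < X)%O](submK ba) ltmc_add2r.
Qed.

Lemma standard_down S b a : standard S a -> (b <= a)%MM -> standard S b.
Proof.
move=> sa ba [r rb rE]; apply: sa; exists ('X_[a - b] * r).
  exact: supp_in_mulX.
by move=> x Sx; rewrite -{1}(submK ba) mpolyXD !evalmpM rE.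
Qed.

(** Otherwise, after division by the leading coefficient, the vanishing of [r] would express its
    leading monomial on [S] through smaller ones. *)
Lemma standard_indep S r : supp_in (standard S) r ->
  (forall x, S x -> evalmp r x = 0) -> r = 0.
Proof.
move=> rS r0; apply/eqP/negPn/negP => nz.
pose a := mlead r; pose c := r@_a.
have nzc : c != 0 by rewrite mleadc_eq0.
apply: (rS a); first exact: mlead_supp.
exists (- c^-1 *: (r - c *: 'X_[a])).
  apply: supp_inZ => b; rewrite (perm_mem (msupp_rem _ _)) mem_rem_uniq //.
  by rewrite inE => /andP[ba /msupp_le_mlead]; rewrite lt_neqAle ba.
move=> x Sx; rewrite evalmpZ evalmpB evalmpZ r0 // sub0r mulrNN mulrA mulVf //.
by rewrite mul1r.
Qed.

(** * Normal forms in terms of standard monomials *)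

Section Reduction.
Variables (S S' : 'cV[C]_m -> Prop).
Hypothesis red : forall a, ~ standard S a ->
  exists2 r, supp_in (fun b => b < a)%O r & forall x, S' x -> evalmp 'X_[a] x = evalmp r x.

(** Well-founded induction along the monomial order. The set [S'] is kept apart from [S] because
    [closed_subgroup_addpoly] takes for it [S] with one more point. *)
Lemma standard_formX a : exists2 r,
  supp_in (fun b => standard S b /\ (b <= a)%O) r &
  forall x, S' x -> evalmp 'X_[a] x = evalmp r x.
Proof.
move: a; apply: ltmwf => a IH; have [sa|/red[r ra rE]] := pselect (standard S a).
  by exists 'X_[a] => // b; rewrite msuppX inE => /eqP ->.
have [|||//|q qS qE] := @supp_in_lin (fun b => b < a)%O
    (fun b => standard S b /\ (b < a)%O) r
    (fun r q => forall x, S' x -> evalmp r x = evalmp q x).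
- by [].
- by move=> c r1 r2 q1 q2 h1 h2 x Sx; rewrite !evalmpD !evalmpZ h1 ?h2.
- move=> b ba; have [q qb qE] := IH b ba; exists q => // d /qb[sd db].
  by split=> //; apply: le_lt_trans db ba.
- by exists q => [b /qS[sb /ltW] //|x Sx]; rewrite rE ?qE.
Qed.

Lemma standard_form r : exists2 q, supp_in (standard S) q &
  forall x, S' x -> evalmp r x = evalmp q x.
Proof.
apply: (@supp_in_lin (fun=> True) (standard S) r
    (fun r q => forall x, S' x -> evalmp r x = evalmp q x)) => //.
  by move=> c r1 r2 q1 q2 h1 h2 x Sx; rewrite !evalmpD !evalmpZ h1 ?h2.
move=> b _; have [q qb qE] := standard_formX b; exists q => // d.
by move=> /qb[].
Qed.

End Reduction.

Section Subgroup.
Variables (S : 'cV[C]_m -> Prop) (p : nat).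
Hypotheses (charC : p \in [pchar C]) (S0 : S 0)
  (SB : forall x y, S x -> S y -> S (x - y)).

Lemma standard0 : standard S 0%MM.
Proof.
move=> [r r0 rE]; have := rE 0 S0; rewrite /evalmp mpolyX0 meval1.
suff -> : r = 0 by rewrite meval0 => /eqP; rewrite oner_eq0.
apply: msuppnil0; case E: (msupp r) => [//|b s]; have := r0 b; rewrite E mem_head => /(_ isT).
by rewrite ltNge lem_leo //; apply/mnm_lepP => i; rewrite mnm0E.
Qed.

(* For f = X^a - r, the difference f(x + s) - f(x) involves standard monomials
   of x only, so it vanishes identically once it vanishes on S: first for s in S,
   giving f(x + s) = f(x), then with the roles of the two variables exchanged. *)
Lemma minimal_nonstandard a : ~ standard S a ->
  (forall b, slt b a -> standard S b) ->
  exists2 r, supp_in (fun b => b < a)%O r &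
    (forall x, S x -> evalmp 'X_[a] x = evalmp r x) /\
    addpoly p (evalmp ('X_[a] - r)).
Proof.
move=> nsa sa.
have [r0 r0a r0E] := contrapT nsa.
have [||||r rS rE] := @supp_in_lin (fun b => b < a)%O
    (fun b => standard S b /\ (b < a)%O) r0
    (fun r q => forall x, S x -> evalmp r x = evalmp q x).
- by [].
- by move=> c r1 r2 q1 q2 h1 h2 x Sx; rewrite !evalmpD !evalmpZ h1 ?h2.
- move=> b ba; have [|q qb qE] := @standard_formX S S _ b.
    by move=> d /contrapT.
  exists q => // d /qb[sd db]; split=> //; exact: le_lt_trans db ba.
- by [].
have rs : supp_in (standard S) r by move=> b /rS[].
exists r => [b /rS[] //|]; split=> [x Sx|]; first by rewrite r0E ?rE.
pose f := 'X_[a] - r.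
have f0 x : S x -> evalmp f x = 0 by move=> Sx; rewrite evalmpB r0E // rE // subrr.
have fs y : supp_in (standard S) (shiftmp y f - f).
  have [q qa qE] := shiftmpX y a.
  rewrite /f shiftmpB qE (_ : _ - _ = q - shiftmp y r + r); last by ring.
  apply: supp_inD => //; apply: supp_inB; first by move=> b /qa /sa.
  by apply: supp_in_shiftmp => // b d; apply: standard_down.
have SD x y : S x -> S y -> S (x + y).
  by move=> Sx Sy; rewrite -[y]opprK -[- y]sub0r; do ?apply: SB.
have finv y x : S y -> evalmp f (x + y) = evalmp f x.
  move=> Sy; apply/eqP; rewrite -subr_eq0 -eval_shiftmp -evalmpB.
  rewrite (standard_indep (fs y)) ?/evalmp ?meval0 // => z Sz.
  by rewrite -/(evalmp _ _) evalmpB eval_shiftmp !f0 ?subrr //; apply: SD.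
apply: addpoly_evalmp => // x y.
(* Here [y] is arbitrary: for [z] in [S], invariance gives [f(z + y) = f(y)], while [f(z) = 0]. The
   constant is admissible because the monomial 1 is standard. *)
have q0 : shiftmp y f - f - (evalmp f y)%:MP = 0.
  apply: (@standard_indep S) => [|z Sz].
    apply: supp_inB => // b; rewrite msuppC; case: eqP => // _.
    by rewrite inE => /eqP ->; exact: standard0.
  rewrite 2!evalmpB eval_shiftmp [z + y]addrC finv // (f0 z) // subr0.
  by rewrite /evalmp mevalC subrr.
move/(congr1 (evalmp^~ x)): q0; rewrite 2!evalmpB eval_shiftmp /evalmp mevalC meval0.
by move/eqP; rewrite subr_eq0 subr_eq => /eqP ->; rewrite addrC.
Qed.

(** Every nonstandard monomial has a reduction valid both on [S] and at [y], derived from additive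
    polynomials vanishing on [S]. So [h] agrees at [y] with its normal form, which vanishes on [S]
    and hence is zero. *)
Lemma closed_subgroup_addpoly y : zariski_closed S ->
  (forall f, addpoly p f -> (forall x, S x -> f x = 0) -> f y = 0) -> S y.
Proof.
move=> [P SE] My; apply/SE => h hP.
pose S' x := S x \/ x = y.
have red a : ~ standard S a -> exists2 r, supp_in (fun b => b < a)%O r &
    forall x, S' x -> evalmp 'X_[a] x = evalmp r x.
  move: a; apply: ltmwf => a IH nsa.
  (* A nonstandard proper divisor passes its reduction on to [a] by multiplication; otherwise [a] is
     minimal and has an additive relation. *)
  have [[b [sba nsb]]|/forallNP min] := pselect (exists b, slt b a /\ ~ standard S b).
    have [r rb rE] := IH b (slt_lt sba) nsb; have ba := sba.1.
    exists ('X_[a - b] * r); first exact: supp_in_mulX.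
    by move=> x Sx; rewrite -{1}(submK ba) mpolyXD !evalmpM rE.
  have [|r ra [rE addr]] := minimal_nonstandard nsa.
    by move=> b sba; apply: contrapT => nsb; apply: (min b).
  exists r => // x [/rE //|->]; apply/eqP; rewrite -subr_eq0 -evalmpB.
  by rewrite My // => z Sz; rewrite evalmpB rE // subrr.
have [q qS qE] := standard_form red h.
rewrite -/(evalmp h y) qE; last by right.
rewrite (standard_indep qS) ?/evalmp ?meval0 // => x Sx.
by rewrite -/(evalmp _ _) -qE; [apply: (SE x).1 | left].
Qed.

End Subgroup.
End ClosedSubgroups.

(** * Twisted polynomials *)

Section TwistedPolynomials.
Variables (C : closedFieldType) (p : nat).
Hypothesis charC : p \in [pchar C].
Implicit Types (f g : {poly C}) (z : C).

(* A polynomial stands for the twisted polynomial with the same coefficients. *)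
Definition tweval f z : C := \sum_(i < size f) f`_i * z ^+ (p ^ i).

Lemma tweval_widen n f z : (size f <= n)%N ->
  tweval f z = \sum_(i < n) f`_i * z ^+ (p ^ i).
Proof.
move=> lefn; rewrite /tweval (big_ord_widen _ (fun i => f`_i * z ^+ (p ^ i)) lefn).
rewrite big_mkcond; apply: eq_bigr => i _; case: ltnP => // lei.
by rewrite nth_default // mul0r.
Qed.

Lemma tweval1 z : tweval 1 z = z.
Proof. by rewrite (@tweval_widen 1) ?size_poly1 // big_ord1 coef1 mul1r expr1. Qed.

Lemma tweval0 z : tweval 0 z = 0.
Proof. by rewrite (@tweval_widen 0) ?size_poly0 // big_ord0. Qed.

Lemma twevalD f g z : tweval (f + g) z = tweval f z + tweval g z.
Proof.
pose n := maxn (size f) (size g).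
rewrite !(@tweval_widen n) ?leq_maxl ?leq_maxr ?size_polyD // -big_split /=.
by apply: eq_bigr => i _; rewrite coefD mulrDl.
Qed.

Lemma twevalZ c f z : tweval (c *: f) z = c * tweval f z.
Proof.
rewrite !(@tweval_widen (size f)) ?size_scale_leq // mulr_sumr.
by apply: eq_bigr => i _; rewrite coefZ mulrA.
Qed.

(** Left multiplication by tau, following the rule [tau c = c^p tau]. *)
Definition twtau f := 'X * map_poly (pFrobenius_aut charC) f.

Lemma twevalX f z : tweval (twtau f) z = tweval f z ^+ p.
Proof.
rewrite (@tweval_widen (size f).+1); last first.
  by rewrite (leq_trans (size_polyMleq _ _)) // size_polyX size_map_poly.
rewrite big_ord_recl coefXM mul0r add0r -(pFrobenius_autE charC) rmorph_sum.
apply: eq_bigr => i _; rewrite coefXM coef_map /= rmorphM /= !pFrobenius_autE.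
by rewrite -exprM -expnSr.
Qed.

Lemma iter_twtau_neq0 k f : f != 0 ->
  iter k twtau f != 0 /\ size (iter k twtau f) = (size f + k)%N.
Proof.
move=> f0; elim: k => [|k [IH0 IHs]]; first by rewrite addn0.
have nz : map_poly (pFrobenius_aut charC) (iter k twtau f) != 0.
  by rewrite map_poly_eq0.
rewrite iterS /twtau mulf_neq0 ?polyX_eq0 // mulrC size_mulX //.
by rewrite size_map_poly IHs addnS.
Qed.

Lemma size_sub_lead f g : f != 0 -> g != 0 -> size f = size g ->
  (size (f - (lead_coef f / lead_coef g) *: g)%R < size f)%N.
Proof.
move=> f0 g0 fg; have f_gt0 : (0 < size f)%N by rewrite lt0n size_poly_eq0.
rewrite -(prednK f_gt0) ltnS; apply/leq_sizeP => i; rewrite leq_eqVlt => /orP[/eqP <-|].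
  rewrite coefB coefZ {2}fg -!lead_coefE divfK ?subrr //.
  by rewrite lead_coef_eq0.
rewrite prednK // => lti; rewrite coefB coefZ !nth_default -?fg ?mulr0 ?subr0 //.
Qed.

(** * Ascending chain condition over the twisted polynomial ring *)

Section Noetherian.
Variable X : Type.
Implicit Types (u v : X -> C) (N : (X -> C) -> Prop).

Record tau_module N : Prop := TauModule {
  tau_module0 : N (fun=> 0);
  tau_moduleD : forall u v, N u -> N v -> N (fun x => u x + v x);
  tau_moduleZ : forall c u, N u -> N (fun x => c * u x);
  tau_moduleX : forall u, N u -> N (fun x => u x ^+ p) }.

Lemma tau_moduleB N u v : tau_module N -> N u -> N v -> N (fun x => u x - v x).
Proof.
move=> mN Nu Nv; have := tau_moduleD mN Nu (tau_moduleZ mN (-1) Nv).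
by congr N; apply: funext => x; rewrite mulN1r.
Qed.

Fixpoint tau_span (us : seq (X -> C)) v : Prop :=
  if us is u :: us' then exists f w, tau_span us' w /\
     v = (fun x => tweval f (u x) + w x)
  else v = (fun=> 0).

Lemma tau_span_module us : tau_module (tau_span us).
Proof.
elim: us => [|u us IH] /=.
  split=> //= [u v -> ->|c u ->|u ->]; apply: funext => x.
  - by rewrite addr0.
  - by rewrite mulr0.
  - by rewrite expr0n; case: p (pchar_gt0 charC).
split=> [|_ _ [f1 [w1 [h1 ->]]] [f2 [w2 [h2 ->]]]|c _ [f [w [h ->]]]|_ [f [w [h ->]]]].
- exists 0, (fun=> 0); split; first exact: tau_module0 IH.
  by apply: funext => x; rewrite tweval0 addr0.
- exists (f1 + f2), (fun x => w1 x + w2 x); split; first exact: tau_moduleD.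
  by apply: funext => x; rewrite twevalD addrACA.
- exists (c *: f), (fun x => c * w x); split; first exact: tau_moduleZ.
  by apply: funext => x; rewrite twevalZ mulrDr.
- exists (twtau f), (fun x => w x ^+ p); split; first exact: tau_moduleX.
  by apply: funext => x; rewrite twevalX (exprp_add charC).
Qed.

Lemma tau_span_mem (I : eqType) (s : seq I) (F : I -> X -> C) i :
  i \in s -> tau_span (map F s) (F i).
Proof.
elim: s => [//|j s IH]; rewrite inE => /orP[/eqP <-|/IH si] /=.
  exists 1, (fun=> 0); split; first exact: tau_module0 (tau_span_module _).
  by apply: funext => x; rewrite tweval1 addr0.
exists 0, (F i); split=> //; by apply: funext => x; rewrite tweval0 add0r.
Qed.

Record twisted_ideal (I : {poly C} -> Prop) : Prop := TwistedIdeal {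
  twisted_ideal0 : I 0;
  twisted_idealD : forall f g, I f -> I g -> I (f + g);
  twisted_idealZ : forall c f, I f -> I (c *: f);
  twisted_idealX : forall f, I f -> I (twtau f) }.

(** Euclidean division: [g] has least size among the nonzero elements of all the ideals and lies in
    [I n0]; subtracting multiples [c tau^k g] brings any element of a later ideal down to zero. *)
Lemma twisted_ideal_acc (I : nat -> {poly C} -> Prop) :
  (forall n, twisted_ideal (I n)) ->
  (forall n k f, (n <= k)%N -> I n f -> I k f) ->
  exists n0, forall n f, (n0 <= n)%N -> I n f -> I n0 f.
Proof.
move=> idI monoI.
pose D d := `[< exists n f, [/\ I n f, f != 0 & size f = d] >].
have [[d Dd]|noD] := pselect (exists d, D d); last first.
  exists 0%N => n f _ If; have [->|f0] := eqVneq f 0.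
    exact: twisted_ideal0.
  by case: noD; exists (size f); apply/asboolP; exists n, f.
have [d0 /asboolP[n0 [g [Ig g0 sg]]] mind0] := ex_minnP (ex_intro _ d Dd).
exists n0 => n f len; move: {2}(size f) (leqnn (size f)) => k.
elim: k f => [|k IH] f lef If.
  by move: lef; rewrite leqn0 size_poly_eq0 => /eqP ->; apply: twisted_ideal0.
have [->|f0] := eqVneq f 0; first exact: twisted_ideal0.
have led : (size g <= size f)%N.
  by rewrite sg; apply: mind0; apply/asboolP; exists n, f.
have [h0 hs] := iter_twtau_neq0 (size f - size g) g0.
rewrite subnKC // in hs; set h := iter _ _ _ in h0 hs.
have Ih : I n0 h.
  rewrite /h; elim: (size f - size g)%N => //= l IHl; exact: twisted_idealX.
pose c := lead_coef f / lead_coef h.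
have Ich : I n0 (c *: h) by apply: twisted_idealZ.
rewrite -[f](subrK (c *: h)); apply: twisted_idealD => //; apply: IH.
  by rewrite -ltnS; apply: leq_trans lef; apply: size_sub_lead.
apply: twisted_idealD => //; rewrite -scaleNr; apply: twisted_idealZ => //.
exact: monoI len Ih.
Qed.

(** Induction on the number of generators, as for finitely generated modules over a noetherian ring:
    the coefficients of the first generator form left ideals, and what remains lies in the span of
    the others. *)
Lemma tau_module_acc us (N : nat -> (X -> C) -> Prop) :
  (forall n, tau_module (N n)) ->
  (forall n k v, (n <= k)%N -> N n v -> N k v) ->
  exists n0, forall n v, (n0 <= n)%N -> tau_span us v -> N n v -> N n0 v.
Proof.
move=> mN monoN; elim: us => [|u us [n1 IH]] /=.
  by exists 0%N => n v _ -> _; apply: tau_module0.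
have mS := tau_span_module us.
pose I n f := exists2 w, tau_span us w & N n (fun x => tweval f (u x) + w x).
have [||n2 I2] := @twisted_ideal_acc I.
- move=> n; split=> [|f g [w1 S1 N1] [w2 S2 N2]|c f [w Sw Nw]|f [w Sw Nw]].
  + exists (fun=> 0); first exact: tau_module0 mS.
    by have := tau_module0 (mN n); congr N; apply: funext => x; rewrite tweval0 addr0.
  + exists (fun x => w1 x + w2 x); first exact: tau_moduleD.
    have := tau_moduleD (mN n) N1 N2; congr N; apply: funext => x.
    by rewrite twevalD addrACA.
  + exists (fun x => c * w x); first exact: tau_moduleZ.
    have := tau_moduleZ (mN n) c Nw; congr N; apply: funext => x.
    by rewrite twevalZ mulrDr.
  + exists (fun x => w x ^+ p); first exact: tau_moduleX.
    have := tau_moduleX (mN n) Nw; congr N; apply: funext => x.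
    by rewrite twevalX (exprp_add charC).
- by move=> n k f nk [w Sw Nw]; exists w => //; apply: monoN nk Nw.
exists (maxn n1 n2) => n v; rewrite geq_max => /andP[n1n n2n] [f [w [Sw vE]]] Nv.
have [|w' Sw' Nw'] := I2 n f n2n; first by exists w; rewrite -?vE.
have N1 := monoN _ _ _ (leq_maxr n1 n2) Nw'.
(* The contributions of [u] cancel in this difference, so the bound [n1] for the other generators
   applies. *)
have N2 : N (maxn n1 n2) (fun x => w x - w' x).
  apply: (monoN _ _ _ (leq_maxl n1 n2)); apply: (IH n) => //; first exact: tau_moduleB.
  have := tau_moduleB (mN n) Nv (monoN _ _ _ n2n Nw'); congr N; apply: funext => x.
  by rewrite vE; ring.
have := tau_moduleD (mN _) N1 N2; congr N; apply: funext => x.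
by rewrite vE; ring.
Qed.

End Noetherian.
End TwistedPolynomials.

(** * Connected subgroups and differentials *)

Section ConnectedSubgroups.
Variables (C : closedFieldType) (p m : nat).
Hypothesis charC : p \in [pchar C].
Implicit Types (f g : 'cV[C]_m -> C) (s : 'cV[C]_m) (S : 'cV[C]_m -> Prop).
Local Notation addpoly := (addpoly p).

Lemma expr_pn_inj n : injective (fun z : C => z ^+ (p ^ n)).
Proof.
elim: n => [|n IH] x y /=; first by rewrite !expr1.
by rewrite expnS !exprM => /IH; apply: exprp_inj.
Qed.

Lemma expr_pn_add n (x y : C) : (x + y) ^+ (p ^ n) = x ^+ (p ^ n) + y ^+ (p ^ n).
Proof. by elim: n => [|n IH]; rewrite ?expr1 // expnSr !exprM IH (exprp_add charC). Qed.

Lemma expr_pn_surj n (x : C) : exists y, y ^+ (p ^ n) = x.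
Proof.
elim: n x => [|n IH] x; first by exists x; rewrite expr1.
have [y <-] := exprp_surj charC x; have [z <-] := IH y.
by exists z; rewrite expnSr exprM.
Qed.

Lemma addpoly_mpoly f : addpoly f -> exists r, f = evalmp r.
Proof.
elim=> [|j|{}f g _ [r ->] _ [q ->]|c {}f _ [r ->]|{}f _ [r ->]].
- by exists 0; apply: funext => x; rewrite /evalmp meval0.
- by exists 'X_j; apply: funext => x; rewrite /evalmp mevalXU.
- by exists (r + q); apply: funext => x; rewrite evalmpD.
- by exists (c *: r); apply: funext => x; rewrite evalmpZ.
- by exists (r ^+ p); apply: funext => x; rewrite /evalmp rmorphXn.
Qed.

Lemma addpoly_at0 f : addpoly f -> f 0 = 0.
Proof.
elim=> [|j|{}f g _ -> _ ->|c {}f _ ->|{}f _ ->] //.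
- by rewrite mxE.
- by rewrite addr0.
- by rewrite mulr0.
- by rewrite expr0n gtn_eqF // (pchar_gt0 charC).
Qed.

Lemma zariski_closed_zero (r : {mpoly C[m]}) : zariski_closed (fun x => evalmp r x = 0).
Proof.
by exists (eq r) => x; split=> [rx _ <-|]; [exact: rx | apply].
Qed.

Lemma addpoly_tau_span f : addpoly f ->
  tau_span p [seq (fun x : 'cV[C]_m => x j 0) | j <- enum 'I_m] f.
Proof.
set us := map _ _; have mS := tau_span_module charC us.
elim=> [|j|{}f g _ Sf _ Sg|c {}f _ Sf|{}f _ Sf].
- exact: tau_module0 mS.
- exact: (tau_span_mem charC (fun j (x : 'cV[C]_m) => x j 0) (mem_enum _ j)).
- exact: (tau_moduleD mS).
- exact: (tau_moduleZ mS).
- exact: (tau_moduleX mS).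
Qed.

(* By noetherianity some w = x_ n satisfies w = h(w^p) on S for a twisted
   polynomial h; since z and 1 - h(z^p)/z have no common zero, connectedness
   of S forces w = 0. *)
Lemma infinitely_tau_divisible S (x_ : nat -> 'cV[C]_m -> C) :
  S 0 -> zariski_connected S -> (forall n, addpoly (x_ n)) ->
  (forall n s, S s -> x_ n s = x_ n.+1 s ^+ p) ->
  forall s, S s -> x_ 0%N s = 0.
Proof.
move=> S0 connS Ox xE.
pose N n g := exists f : {poly C}, forall s, S s -> g s = tweval p f (x_ n s).
have mN n : tau_module p (N n).
  split=> [|u v [f fE] [g gE]|c u [f fE]|u [f fE]].
  - by exists 0 => s _; rewrite tweval0.
  - by exists (f + g) => s Ss; rewrite twevalD fE ?gE.
  - by exists (c *: f) => s Ss; rewrite twevalZ fE.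
  - by exists (twtau charC f) => s Ss; rewrite twevalX fE.
have monoN n k v : (n <= k)%N -> N n v -> N k v.
  elim: k => [|k IH]; first by rewrite leqn0 => /eqP ->.
  rewrite leq_eqVlt => /orP[/eqP -> //|lenk /(IH lenk) [f fE]].
  (* Right multiplication by tau shifts the coefficients unchanged: [f(x_k) = (f tau)(x_(k+1))]. *)
  exists (\poly_(i < (size f).+1) if i is j.+1 then f`_j else 0) => s Ss.
  rewrite (tweval_widen _ _ (size_poly _ _)) big_ord_recl coef_poly mul0r add0r.
  rewrite fE //; apply: eq_bigr => i _; rewrite coef_poly /= ltnS ltn_ord.
  by rewrite xE // -exprM -expnS.
have [n0 stab] := tau_module_acc charC
  [seq (fun x : 'cV[C]_m => x j 0) | j <- enum 'I_m] mN monoN.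
have [f fE] : N n0 (x_ n0.+1).
  apply: (stab n0.+1) => //; first exact: addpoly_tau_span.
  by exists 1 => s _; rewrite tweval1.
have p0 := pchar_gt0 charC.
have w0 s : S s -> x_ n0.+1 s = 0.
  have [r rE] := addpoly_mpoly (Ox n0.+1).
  (* With this choice [r q = r - f(r^p)] vanishes on [S], and [q = 1] wherever [r = 0] because the
     exponents [p^(i+1) - 1] are positive. *)
  pose q := 1 - \sum_(i < size f) f`_i *: r ^+ (p ^ i.+1).-1.
  have qE s' : evalmp q s' =
      1 - \sum_(i < size f) f`_i * evalmp r s' ^+ (p ^ i.+1).-1.
    rewrite evalmpB /evalmp meval1 (raddf_sum (meval (fun k => s' k 0))) /=; congr (1 - _).
    by apply: eq_bigr => i _; rewrite mevalZ rmorphXn.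
  have pow0 i : f`_i * 0 ^+ (p ^ i.+1).-1 = 0.
    rewrite expr0n -subn1 subn_eq0 leqNgt -[X in (X < _)%N](expn0 p).
    by rewrite ltn_exp2l ?mulr0 //; exact/prime_gt1/(pcharf_prime charC).
  have [z Sz|z Sz rz||] := connS _ _ (zariski_closed_zero r) (zariski_closed_zero q).
  - have [->|rz] := eqVneq (evalmp r z) 0; [by left | right].
    apply: (mulfI rz); rewrite mulr0 qE mulrBr mulr1 mulr_sumr.
    apply/eqP; rewrite subr_eq0 -{1}rE fE //; apply/eqP/eq_bigr => i _.
    rewrite xE // rE mulrCA -exprS prednK ?expn_gt0 ?p0 //.
    by rewrite -exprM -expnS.
  - rewrite qE rz big1 ?subr0 => [/eqP|i _]; first by rewrite oner_eq0.
    exact: pow0.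
  - by rewrite rE; apply.
  - move=> /(_ 0 S0); rewrite qE -rE addpoly_at0 // big1 ?subr0 => [/eqP|i _].
      by rewrite oner_eq0.
    exact: pow0.
suff xn0 n s : (n <= n0.+1)%N -> S s -> x_ (n0.+1 - n)%N s = 0.
  by move=> s Ss; rewrite -(subnn n0.+1) xn0.
elim: n => [|n IH] len Ss; first by rewrite subn0 w0.
by rewrite xE // -subSn // subSS IH // ?expr0n ?gtn_eqF // ltnW.
Qed.

(** Since [C] is perfect, the terms of positive degree in [tau_p] form a [p]-th power; thus [G] is
    an additive polynomial map with derivative [A]. *)
Definition differential (A : 'M[C]_m) (G : 'cV[C]_m -> 'cV[C]_m) : Prop :=
  exists2 H : 'I_m -> 'cV[C]_m -> C, forall k, addpoly (H k) &
    forall x k, G x k 0 = (A *m x) k 0 + H k x ^+ p.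

Lemma differential_addpoly A G k : differential A G -> addpoly (fun x => G x k 0).
Proof.
move=> [H OH GE].
have OA : addpoly (fun x => \sum_j A k j * x j 0).
  by apply: addpoly_sum => j; apply/addpolyZ/addpoly_coord.
apply: addpoly_ext (addpolyD OA (addpolyX (OH k))) => x.
by rewrite GE mxE.
Qed.

Lemma addpoly_comp A G f : differential A G -> addpoly f -> addpoly (fun x => f (G x)).
Proof.
move=> dG; elim=> [|j|{}f g _ Of _ Og|c {}f _ Of|{}f _ Of].
- exact: addpoly0.
- exact: differential_addpoly dG.
- exact: addpolyD.
- exact: addpolyZ.
- exact: addpolyX.
Qed.

(** A scalar commutes with the linear part of [f], so composition with [G] multiplies [f] by [b] up
    to a [p]-th power. *)
Lemma addpoly_comp_scalar b G f : differential b%:M G -> addpoly f ->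
  exists2 y, addpoly y & forall x, f (G x) = b * f x + y x ^+ p.
Proof.
move=> dG; elim=> [|j|{}f g _ [y1 O1 E1] _ [y2 O2 E2]|c {}f _ [y O E]|{}f Of _].
- exists (fun=> 0) => [|x]; first exact: addpoly0.
  by rewrite mulr0 expr0n gtn_eqF ?addr0 // (pchar_gt0 charC).
- have [H OH GE] := dG; exists (H j) => // x.
  by rewrite GE mul_scalar_mx mxE.
- exists (fun x => y1 x + y2 x) => [|x]; first exact: addpolyD.
  by rewrite E1 E2 (exprp_add charC) mulrDr addrACA.
- have [d <-] := exprp_surj charC c.
  exists (fun x => d * y x) => [|x]; first exact: addpolyZ.
  by rewrite E exprMn; ring.
- have [d <-] := exprp_surj charC b.
  exists (fun x => f (G x) - d * f x) => [|x].
    by apply: addpolyB; [exact: addpoly_comp dG Of | exact: addpolyZ].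
  by rewrite (exprp_sub charC) exprMn addrC subrK.
Qed.

(* If f vanishes on S, then f o theta is a p^n-th power of an additive
   polynomial on S for every n: for n > 0 the multipliers b and b^(1/p^n) of
   alpha on the two sides of f o theta = x^(p^n) differ, so x has no linear
   part modulo the additive polynomials vanishing on S. *)
Lemma subgroup_stable S (b c : C) (alpha theta : 'cV[C]_m -> 'cV[C]_m) :
  conn_alg_subgroup S ->
  differential b%:M alpha -> differential c%:M theta ->
  (forall n, (0 < n)%N -> b ^+ (p ^ n) != b) ->
  (forall x, theta (alpha x) = alpha (theta x)) ->
  (forall s, S s -> S (alpha s)) -> forall s, S s -> S (theta s).
Proof.
move=> [S0 SB closedS connS] da dt bn comm Sa s0 Ss0.
apply: (closed_subgroup_addpoly charC S0 SB) => // f Of f0.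
(* The claim is general in [g] because the induction hypothesis is used for [g] and also for [y],
   which again vanishes on [S]. *)
have step n g : addpoly g -> (forall s, S s -> g s = 0) ->
    exists2 x, addpoly x & forall s, S s -> g (theta s) = x s ^+ (p ^ n).
  elim: n g => [|n IH] g Og g0.
    exists (fun s => g (theta s)) => [|s _]; last by rewrite expr1.
    exact: addpoly_comp dt Og.
  (* For exponent 0 the multipliers [b] and [b'] coincide; there the scalar differential of [theta]
     gives the [p]-th power directly. *)
  have [n0|n_gt0] := posnP n.
    rewrite n0 expn1; have [y Oy yE] := addpoly_comp_scalar dt Og.
    by exists y => // s Ss; rewrite yE g0 // mulr0 add0r.
  have [x Ox xE] := IH g Og g0.
  have [y Oy yE] := addpoly_comp_scalar da Og.
  have [|x' Ox' x'E] := IH y Oy.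
    move=> s Ss; apply: (exprp_inj charC); rewrite /= expr0n.
    rewrite gtn_eqF ?(pchar_gt0 charC) //.
    by have := yE s; rewrite !g0 ?mulr0 ?add0r //; apply: Sa.
  have [b' bE] := expr_pn_surj n b.
  have [y' Oy' y'E] := addpoly_comp_scalar da Ox.
  (* Evaluate [g o theta o alpha = g o alpha o theta] on [S] through [x] and [x'], then take
     [p^n]-th roots. *)
  have xa s : S s -> x (alpha s) = b' * x s + x' s ^+ p.
    move=> Ss; apply: (@expr_pn_inj n); rewrite /= -xE ?comm; last exact: Sa.
    rewrite yE xE // x'E // expr_pn_add exprMn bE.
    by rewrite -!exprM mulnC.
  have nz : b' - b != 0.
    rewrite subr_eq0; apply: contraNneq (bn n n_gt0) => e.
    by rewrite -{2}bE e.
  have [d dE] := exprp_surj charC (b' - b)^-1.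
  (* Equating [b x + y'^p] with [b' x + x'^p] gives [(b' - b) x = (y' - x')^p], and [d^p] inverts
     [b' - b]. *)
  exists (fun s => d * (y' s - x' s)) => [|s Ss].
    by apply/addpolyZ/addpolyB.
  rewrite xE // expnS exprM; congr (_ ^+ _).
  rewrite exprMn (exprp_sub charC) dE; apply: (mulfI nz); rewrite mulVKf //.
  have := xa s Ss; rewrite y'E => /eqP; rewrite -subr_eq0 => /eqP e.
  by apply/eqP; rewrite -subr_eq0 -oppr_eq0 -e; apply/eqP; ring.
have /choice[x_ xP] n : exists x, addpoly x /\
    forall s, S s -> f (theta s) = x s ^+ (p ^ n).
  by have [x Ox xE] := step n f Of f0; exists x.
have := xP 0%N => -[_ /(_ s0 Ss0) ->]; rewrite expr1.
apply: (@infinitely_tau_divisible S) => // [n|n s Ss]; first exact: (xP n).1.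
apply: (@expr_pn_inj n); rewrite /= -(xP n).2 // (xP n.+1).2 //.
by rewrite expnS exprM.
Qed.

End ConnectedSubgroups.

(** * Application to T-modules *)

Section Differentials.
Variables (C : closedFieldType) (p m : nat).
Hypothesis charC : p \in [pchar C].
Implicit Types (A B : 'M[C]_m) (G H : 'cV[C]_m -> 'cV[C]_m).
Local Notation differential := (@differential C p m).

Lemma differential_ext A G H : G =1 H -> differential A G -> differential A H.
Proof. by move=> /funext ->. Qed.

Lemma differential0 : differential 0 (fun=> 0).
Proof.
exists (fun _ _ => 0) => [k|x k]; first exact: addpoly0.
by rewrite mul0mx !mxE expr0n gtn_eqF ?addr0 // (pchar_gt0 charC).
Qed.

Lemma differential_mulmx A : differential A (mulmx A).
Proof.
exists (fun _ _ => 0) => [k|x k]; first exact: addpoly0.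
by rewrite expr0n gtn_eqF ?addr0 // (pchar_gt0 charC).
Qed.

Lemma differentialD A B G H : differential A G -> differential B H ->
  differential (A + B) (fun x => G x + H x).
Proof.
move=> [G' OG GE] [H' OH HE].
exists (fun k x => G' k x + H' k x) => [k|x k]; first exact: addpolyD.
by rewrite mxE GE HE mulmxDl [in RHS]mxE (exprp_add charC) addrACA.
Qed.

Lemma differentialZ c A G : differential A G ->
  differential (c *: A) (fun x => c *: G x).
Proof.
move=> [G' OG GE]; have [d dE] := exprp_surj charC c.
exists (fun k x => d * G' k x) => [k|x k]; first exact: addpolyZ.
by rewrite mxE GE -scalemxAl [in RHS]mxE exprMn dE mulrDr.
Qed.

Lemma differential_sum n (A : 'I_n -> 'M[C]_m) (G : 'I_n -> 'cV[C]_m -> 'cV[C]_m) :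
  (forall i, differential (A i) (G i)) ->
  differential (\sum_i A i) (fun x => \sum_i G i x).
Proof.
move=> AG; elim: (index_enum _) => [|i r IH].
  by rewrite big_nil; apply: differential_ext differential0 => x; rewrite big_nil.
rewrite big_cons; apply: differential_ext (differentialD (AG i) IH) => x.
by rewrite big_cons.
Qed.

Lemma differential_comp A B G H : differential A G -> differential B H ->
  differential (A *m B) (fun x => G (H x)).
Proof.
move=> [G' OG GE] dH; have [H' OH HE] := dH.
have /choice[d dE] (kl : 'I_m * 'I_m) : exists d, d ^+ p = A kl.1 kl.2.
  exact: exprp_surj.
exists (fun k x => \sum_l d (k, l) * H' l x + G' k (H x)) => [k|x k].
  apply: addpolyD; last exact: addpoly_comp dH _.
  by apply: addpoly_sum => l; apply: addpolyZ.
rewrite GE (exprp_add charC) addrA -mulmxA; congr (_ + _).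
rewrite -(pFrobenius_autE charC) rmorph_sum /= !mxE -big_split /=.
apply: eq_bigr => l _.
by rewrite HE mulrDr pFrobenius_autE exprMn dE.
Qed.

Lemma differential_iter n A G : differential A G ->
  differential (A ^+ n) (iter n G).
Proof.
move=> dG; elim: n => [|n IH]; last first.
  by rewrite exprS; exact: differential_comp dG IH.
by apply: differential_ext (differential_mulmx _) => x; rewrite expr0 mul1mx.
Qed.

End Differentials.

(** * Differential and commutation of the maps [Phi(a)] *)

Section Tmodules.
Variables (F : finFieldType) (C : closedFieldType) (iota : {rmorphism F -> C}).
Variables (p m e : nat).
Hypotheses (charC : p \in [pchar C]) (cardF : #|F| = (p ^ e.+1)%N).

Lemma differential_frob_gt0 i (A : 'M[C]_m) : (0 < i)%N ->
  differential p (0 : 'M[C]_m) (fun x => A *m frobn F i x).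
Proof.
case: i => // i _.
have /choice[d dE] (kl : 'I_m * 'I_m) : exists d, d ^+ p = A kl.1 kl.2.
  exact: exprp_surj.
have qE : (#|F| ^ i.+1 = p ^ (e.+1 * i.+1).-1 * p)%N.
  by rewrite cardF -expnM -expnSr prednK.
exists (fun k x => \sum_l d (k, l) * x l 0 ^+ (p ^ (e.+1 * i.+1).-1)) => [k|x k].
  by apply: addpoly_sum => l; apply/addpolyZ/addpolyXn/addpoly_coord.
rewrite mul0mx -(pFrobenius_autE charC) rmorph_sum !mxE add0r.
by apply: eq_bigr => l _; rewrite !mxE /= pFrobenius_autE exprMn dE qE exprM.
Qed.

Lemma differential_apply_tw (s : seq 'M[C]_m) :
  differential p s`_0 (apply_tw F s).
Proof.
case: s => [|A s].
  by apply: differential_ext (differential0 m charC) => x; rewrite /apply_tw big_ord0.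
pose B (i : 'I_(size (A :: s))) := if i == 0 :> nat then A else 0 : 'M[C]_m.
have -> : (A :: s)`_0 = \sum_i B i.
  by rewrite big_ord_recl big1 ?addr0.
apply: (differential_sum charC (G := fun i x => (A :: s)`_i *m frobn F i x)) => i.
rewrite /B; case: posnP => [->|]; last exact: differential_frob_gt0.
apply: differential_ext (differential_mulmx charC A) => x.
by congr (_ *m _); apply/matrixP => k l; rewrite mxE expr1.
Qed.

Lemma frobnD n (x y : 'cV[C]_m) : frobn F n (x + y) = frobn F n x + frobn F n y.
Proof.
apply/matrixP => k l; rewrite !mxE cardF -expnM.
exact: (expr_pn_add charC).
Qed.

Lemma expf_cardX (c : F) n : c ^+ (#|F| ^ n) = c.
Proof.
elim: n => [|n IH]; first by rewrite expr1.
by rewrite expnSr exprM IH expf_card.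
Qed.

Lemma frobnZ n (c : F) (x : 'cV[C]_m) :
  frobn F n (iota c *: x) = iota c *: frobn F n x.
Proof.
apply/matrixP => k l; rewrite !mxE exprMn -rmorphXn.
by rewrite expf_cardX.
Qed.

Lemma apply_twD (s : seq 'M[C]_m) x y :
  apply_tw F s (x + y) = apply_tw F s x + apply_tw F s y.
Proof.
by rewrite -big_split; apply: eq_bigr => i _; rewrite frobnD mulmxDr.
Qed.

Lemma apply_twZ (s : seq 'M[C]_m) (c : F) x :
  apply_tw F s (iota c *: x) = iota c *: apply_tw F s x.
Proof.
by rewrite scaler_sumr; apply: eq_bigr => i _; rewrite frobnZ scalemxAr.
Qed.

Lemma apply_tw0 (s : seq 'M[C]_m) : apply_tw F s 0 = 0.
Proof. by rewrite -(scale0r 0) -(rmorph0 iota) apply_twZ rmorph0 !scale0r. Qed.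

(** The coefficients of [a] come from [F] and are fixed by the [q]-power map, so [Phi(T)] is linear
    over them. *)
Lemma apply_tw_Phi (s : seq 'M[C]_m) a x :
  apply_tw F s (Phi iota s a x) = Phi iota s a (apply_tw F s x).
Proof.
rewrite /Phi (big_morph _ (apply_twD s) (apply_tw0 s)).
by apply: eq_bigr => i _; rewrite apply_twZ -iterSr.
Qed.

Lemma PhiXn (s : seq 'M[C]_m) n x : Phi iota s 'X^n x = iter n (apply_tw F s) x.
Proof.
rewrite /Phi size_polyXn big_ord_recr /= coefXn eqxx rmorph1 scale1r big1 ?add0r //.
by move=> i _; rewrite coefXn ltn_eqF // rmorph0 scale0r.
Qed.

End Tmodules.

Lemma differential_Phi (F : finFieldType) (C : closedFieldType)
  (iota : {rmorphism F -> C}) (p m e : nat) (s : seq 'M[C]_m.+1) (a : {poly F}) :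
  p \in [pchar C] -> #|F| = (p ^ e.+1)%N ->
  differential p (horner_mx s`_0 (map_poly iota a)) (Phi iota s a).
Proof.
move=> charC cardF.
have -> : horner_mx s`_0 (map_poly iota a) = \sum_(k < size a) iota a`_k *: s`_0 ^+ k.
  rewrite -[map_poly iota a]coefK poly_def size_map_poly rmorph_sum /=.
  by apply: eq_bigr => k _; rewrite horner_mxZ rmorphXn /= horner_mx_X coef_map.
apply: differential_sum => // k; apply/differentialZ/differential_iter => //.
exact: differential_apply_tw cardF _.
Qed.

(* P - P(t) is a multiple of X - t. *)
Lemma horner_mx_exp_pn (C : closedFieldType) (p m n : nat) (A : 'M[C]_m.+1) (t : C)
  (P : {poly C}) : p \in [pchar C] -> (A - t%:M) ^+ n = 0 ->
  horner_mx A P ^+ (p ^ n) = (P.[t] ^+ (p ^ n))%:M.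
Proof.
move=> charC nil.
have /factor_theorem[Q QE] : root (P - P.[t]%:P) t.
  by rewrite rootE !hornerE subrr.
have pP : [pchar {poly C}].-nat (p ^ n)%N.
  by rewrite (eq_pnat _ (pchar_poly C)) pnatX pnatE ?charC // (pcharf_prime charC).
rewrite -[P in LHS](subrK P.[t]%:P) -rmorphXn QE exprDn_pchar // exprMn.
rewrite rmorphD rmorphM rmorphXn rmorphXn rmorphXn /=.
rewrite rmorphB /= horner_mx_X !horner_mx_C.
(* This follows from [n <= p^n]. *)
have -> : (A - t%:M) ^+ (p ^ n) = 0.
  rewrite -(subnK (ltnW (ltn_expl n (prime_gt1 (pcharf_prime charC))))) exprD nil.
  by rewrite mulr0.
rewrite mulr0 add0r; exact: esym (rmorphXn (@scalar_mx C m.+1) _ _).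
Qed.

Lemma pchar_card (F : finFieldType) :
  exists p e, p \in [pchar F] /\ #|F| = (p ^ e.+1)%N.
Proof.
have [p _ charF] := finPcharP F; exists p.
have cF : #|F| = (p ^ logn p #|F|)%N := card_pprimeChar charF.
exists (logn p #|F|).-1; split=> //; rewrite prednK // lt0n.
apply/eqP => l0; have := card_finNzRing_gt1 F.
by rewrite cF l0.
Qed.

Unset Implicit Arguments.

Theorem theorem7 (F : finFieldType) (C : closedFieldType)
  (iota : {rmorphism F -> C}) (t : C) (R : realType) (av : C -> R) :
  Cinfty_model iota t av ->
  forall (m : nat) (K : C -> Prop) (phiT : seq 'M[C]_m),
    is_subfield K ->
    (forall x, K x -> algebraic_k iota t x) ->
    is_Tmodule t K phiT ->
    is_abelian F K phiT ->
    is_uniformizable F av phiT ->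
    exists j : nat, (0 < j)%N /\
      forall B : {poly F} -> Prop,
        is_subring B ->
        (exists b, B b /\ (1 < size b)%N) ->
        forall S : 'cV[C]_m -> Prop,
          sub_B_module iota phiT B S -> sub_a_module iota phiT ('X^j) S.
Proof.
move=> CM m K phiT _ _ [_ _ [n nil]] _ _.
have [p [e [charF cardF]]] := pchar_card F.
have charC := rmorph_pchar iota charF.
have pgt1 := prime_gt1 (pcharf_prime charC).
exists (p ^ n)%N; split; first by rewrite expn_gt0 ltnW.
move=> B _ [a [Ba sa]] S [connS SB]; split=> //.
(* [horner_mx] needs a nonzero matrix ring; in dimension 0 the only vector is 0. *)
case: m => [|m] in phiT nil S connS SB *.
  by move=> x Sx; rewrite [Phi _ _ _ _]flatmx0 -[0](flatmx0 x).
have ev (c : {poly F}) : differential p (evalA iota t c ^+ (p ^ n))%:M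
    (iter (p ^ n) (Phi iota phiT c)).
  rewrite -(horner_mx_exp_pn _ charC nil); apply: differential_iter => //.
  exact: differential_Phi cardF.
(* Here [alpha] is [Phi(a)^(p^n)] and [theta] is [Phi(T^(p^n))], with scalar differentials
   [a(t)^(p^n)] and [t^(p^n)]. *)
apply: (subgroup_stable charC connS (ev a)).
- have := ev 'X; rewrite /evalA map_polyX hornerX => dX.
  apply: differential_ext dX => x; rewrite PhiXn; apply: eq_iter => {}x.
  by rewrite -['X]expr1 PhiXn.
(* As [t] is transcendental, equality would force two different powers of the nonconstant polynomial
   [a] to coincide, against their degrees. *)
- move=> k k_gt0; rewrite -exprM; apply/negP => /eqP.
  rewrite /evalA -!horner_exp -!rmorphXn => /eqP; rewrite -subr_eq0.
  rewrite -hornerN -hornerD -rmorphB => /eqP /(t_transc CM) /eqP.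
  rewrite subr_eq0 => /eqP /(congr1 (fun q : {poly F} => (size q).-1)).
  rewrite !size_exp => /eqP; rewrite eqn_pmul2l; last by rewrite -ltnS prednK // ltnW.
  rewrite -[X in _ == X]muln1 eqn_pmul2l ?expn_gt0 ?(ltnW pgt1) //.
  by rewrite gtn_eqF // -[X in (X < _)%N](expn0 p) ltn_exp2l.
- have commT x : Phi iota phiT 'X^(p ^ n) (Phi iota phiT a x) =
      Phi iota phiT a (Phi iota phiT 'X^(p ^ n) x).
    rewrite !PhiXn; elim: (p ^ n)%N => //= k ->.
    exact: apply_tw_Phi charC cardF _ _ _.
  by move=> x; elim: {2 3}(p ^ n)%N => //= k <-; rewrite commT.
- by move=> s Ss; elim: (p ^ n)%N => //= k; apply: SB.
Qed.
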